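(* Let $\lambda$ and $\mu$ be arbitrary partitions, and let $x_1,x_2,\dots,y_1,y_2,\dots$ be commuting indeterminates. Then $$\Bigg( \sum_{\substack{k\ge1:\ \nexists\, i\ge1 \colon \lambda_k - k = \mu_i - i}} x_k + \sum_{\substack{k\ge1:\ \nexists\, j\ge1 \colon \lambda'_k - k = \mu'_j - j}} y_k \Bigg) \sum_{D \in \mathcal E(\lambda/\mu)} \prod_{(i,j) \in D} (x_i + y_j) = \sum_{\mu \lessdot \nu \subseteq \lambda}\ \sum_{D \in \mathcal E(\lambda/\nu)} \prod_{(i,j) \in D} (x_i + y_j),$$ where the outer sum on the right runs over all partitions $\nu$ with $\nu \subseteq \lambda$ and $\mu \lessdot \nu$.
   Context: Partitions are extended by zeros: $\lambda_i = 0$ for $i > \ell(\lambda)$; $\lambda'$ denotes the conjugate partition, $\lambda'_j=\#\{i:\lambda_i\ge j\}$. The diagram of $\lambda$ is $[\lambda] = \{(i,j) : i \geq 1,\ 1 \leq j \leq \lambda_i\}$; $\mu \subseteq \lambda$ means $[\mu]\subseteq[\lambda]$, and $\mu \lessdot \nu$ means $\mu \subseteq \nu$ and $|\nu| = |\mu|+1$. For a set $D \subseteq [\lambda]$, if $(i,j) \in D$ and $(i+1,j),(i,j+1),(i+1,j+1) \in [\lambda] \setminus D$, then an excited move (with respect to $\lambda$) replaces $D$ by $(D \setminus \{(i,j)\}) \cup \{(i+1,j+1)\}$. The set $\mathcal E(\lambda/\mu)$ of excited diagrams consists of all subsets of $[\lambda]$ obtainable from $[\mu]$ by a finite sequence of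 excited moves; it is empty if $\mu \not\subseteq \lambda$. *)

(* Defs.v *)
From HB Require Import structures.
From Stdlib Require Import Relation_Operators.
From mathcomp Require Import all_boot all_order all_algebra.
From mathcomp Require Import finmap.
From mathcomp Require Import boolp classical_sets functions cardinality fsbigop.
From mathcomp Require Import monalg.

Set Implicit Arguments.
Unset Strict Implicit.
Unset Printing Implicit Defensive.

Import Order.TTheory GRing.Theory Num.Theory.

Local Open Scope classical_set_scope.
Local Open Scope ring_scope.

(* All indices (rows, columns, parts, variables) are 1-based. *)

Record intpart := IntPart {
  parts :> seq nat;
  partsP : sorted geq parts && (0%N \notin parts) }.

HB.instance Definition _ := [isSub for parts].
HB.instance Definition _ := [Choice of intpart by <:].

(* Meaningful for i >= 1; gives 0 when i exceeds the length. *)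
Definition part (la : intpart) (i : nat) : nat := nth 0%N la i.-1.

(* Meaningful for j >= 1: the zeros extending la then do not count. *)
Definition conj_part (la : intpart) (j : nat) : nat :=
  count (fun p => j <= p)%N la.

Definition weight (la : intpart) : nat := sumn la.

Definition diagram (la : intpart) : set (nat * nat) :=
  [set c | (1 <= c.1)%N /\ (1 <= c.2 <= part la c.1)%N].

Definition covers (mu nu : intpart) : Prop :=
  diagram mu `<=` diagram nu /\ weight nu = (weight mu).+1.

Definition excited_move (la : intpart) (D D' : set (nat * nat)) : Prop :=
  D `<=` diagram la /\
  exists i j : nat,
    [/\ D (i, j),
        (diagram la `\` D) (i.+1, j),
        (diagram la `\` D) (i, j.+1),
        (diagram la `\` D) (i.+1, j.+1)
      & D' = (D `\ (i, j)) `|` [set (i.+1, j.+1)]].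

(* Empty when [mu] is not contained in [la]: the starting point then is not a
   subset of [la], and no move applies to it. *)
Definition excited_diagrams (la mu : intpart) : set (set (nat * nat)) :=
  [set D | D `<=` diagram la /\
           clos_refl_trans _ (excited_move la) (diagram mu) D].

Definition row_indices (la mu : intpart) : set nat :=
  [set k | (1 <= k)%N /\
    ~ exists i : nat, (1 <= i)%N /\
        (part la k)%:Z - k%:Z = (part mu i)%:Z - i%:Z].

Definition col_indices (la mu : intpart) : set nat :=
  [set k | (1 <= k)%N /\
    ~ exists j : nat, (1 <= j)%N /\
        (conj_part la k)%:Z - k%:Z = (conj_part mu j)%:Z - j%:Z].

(* Polynomials over R in the indeterminates inl i (for x_i) and inr j (for
   y_j). *)
Definition xypoly (R : comNzRingType) : comNzRingType :=
  {malg R[{cmonom (nat + nat)%type}]}.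

Definition xvar (R : comNzRingType) (i : nat) : xypoly R :=
  mkmalgU (ucm (inl i : nat + nat)%type) 1.

Definition yvar (R : comNzRingType) (j : nat) : xypoly R :=
  mkmalgU (ucm (inr j : nat + nat)%type) 1.

Definition cell_weight (R : comNzRingType) (D : set (nat * nat)) : xypoly R :=
  \big[*%R/1]_(c \in D) (xvar R c.1 + yvar R c.2).

(* \big[op/idx]_(i \in A) is idx when the support is infinite; the lemmas below
   show that all the sets indexing a sum or a product are finite. *)

Lemma part_le_weight (la : intpart) i : (part la i <= weight la)%N.
Proof.
rewrite /part /weight; elim: (parts la) i.-1 => [|p s IH] [|n] //=.
  by rewrite leq_addr.
by rewrite (leq_trans (IH n)) // leq_addl.
Qed.

Lemma size_le_weight (la : intpart) : (size la <= weight la)%N.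
Proof.
case: la => s sP; rewrite /weight /=; case/andP: sP => _.
elim: s => //= p s IH; rewrite in_cons negb_or eq_sym -lt0n => /andP[p0 s0].
by rewrite -add1n leq_add ?IH.
Qed.

Lemma part_default (la : intpart) i : (weight la < i)%N -> part la i = 0%N.
Proof.
case: i => // i; rewrite ltnS => lei.
by rewrite /part nth_default //= (leq_trans (size_le_weight la)).
Qed.

Lemma conj_part_default (la : intpart) j :
  (weight la < j)%N -> conj_part la j = 0%N.
Proof.
move=> ltj; apply/eqP; rewrite /conj_part eqn0Ngt -has_count; apply/hasPn => p.
move=> /(nthP 0%N)[i _ <-]; rewrite -ltnNge.
by rewrite (leq_ltn_trans (part_le_weight la i.+1)).
Qed.

Lemma finite_diagram (la : intpart) : finite_set (diagram la).
Proof.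
apply: (@sub_finite_set _ _ (`I_(weight la).+1 `*` `I_(weight la).+1)).
  move=> [i j] /= [i1 /andP[j1 jle]]; split=> /=.
    rewrite ltnS leqNgt; apply/negP => /part_default Z.
    by move: jle; rewrite Z leqn0 => /eqP jz; rewrite jz in j1.
  by rewrite ltnS (leq_trans jle) // part_le_weight.
exact: finite_setX.
Qed.

Lemma finite_subsets (T : choiceType) (A : set T) :
  finite_set A -> finite_set [set B : set T | B `<=` A].
Proof.
move=> finA.
apply: (@sub_finite_set _ _
  ((fun X : {fset T} => [set` X]) @` [set` fpowerset (fset_set A)])).
  move=> B /= BA; have finB : finite_set B by exact: sub_finite_set finA.
  exists (fset_set B); last by rewrite fset_setK.
  by rewrite /= fpowersetE -fset_set_sub.
exact/finite_image/finite_fset.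
Qed.

Lemma finite_excited_diagrams (la mu : intpart) :
  finite_set (excited_diagrams la mu).
Proof.
apply: sub_finite_set (finite_subsets (finite_diagram la)).
by move=> D [].
Qed.

Lemma finite_row_indices (la mu : intpart) : finite_set (row_indices la mu).
Proof.
apply: (@sub_finite_set _ _ `I_(maxn (weight la) (weight mu)).+1) => //.
move=> k [k1 nk] /=; rewrite ltnS leqNgt gtn_max; apply/negP => /andP[l m].
by apply: nk; exists k; rewrite !part_default.
Qed.

Lemma finite_col_indices (la mu : intpart) : finite_set (col_indices la mu).
Proof.
apply: (@sub_finite_set _ _ `I_(maxn (weight la) (weight mu)).+1) => //.
move=> k [k1 nk] /=; rewrite ltnS leqNgt gtn_max; apply/negP => /andP[l m].
by apply: nk; exists k; rewrite !conj_part_default.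
Qed.

Lemma diagram_inj : injective diagram.
Proof.
move=> la mu E.
have le (a b : intpart) i : diagram a = diagram b ->
    (part a i.+1 <= part b i.+1)%N.
  move=> Eab; case: (posnP (part a i.+1)) => [->//|a0].
  have : diagram a (i.+1, part a i.+1) by split=> //=; rewrite a0 leqnn.
  by rewrite Eab => -[_ /= /andP[]].
have eqp i : nth 0%N la i = nth 0%N mu i.
  by apply/eqP; rewrite eqn_leq (le la mu i) // (le mu la i).
have sz (a b : intpart) : (forall i, nth 0%N a i = nth 0%N b i) ->
    (size a <= size b)%N.
  move=> Eab; rewrite leqNgt; apply/negP => lt.
  case/andP: (partsP a) => _ /negP; apply.
  by rewrite -(nth_default 0%N (leqnn (size b))) -Eab mem_nth.
apply: val_inj; apply: (@eq_from_nth _ 0%N) => //=.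
by apply/eqP; rewrite eqn_leq !sz.
Qed.

Lemma finite_covers_in (la mu : intpart) :
  finite_set [set nu : intpart | covers mu nu /\ diagram nu `<=` diagram la].
Proof.
apply: (@sub_finite_set _ _
  (diagram @^-1` [set B | B `<=` diagram la])) => [nu []//|].
apply: finite_preimage (finite_subsets (finite_diagram la)).
by move=> ? ? _ _; exact: diagram_inj.
Qed.

(* Main.v *)
(** Write F(la, mu) for the sum over excited diagrams, A(la, mu) for the linear
    factor, and M for the set of contents mu_i - i. Remove a corner c = (a, b)
    of content d from la to get la', and put w = x_a + y_b. Sorting the excited
    diagrams by whether they contain c gives
      F(la, mu) = F(la', mu) + w F(la', mu - d),
    where mu - d is mu without its corner of content d (no such term if there
    is none). Since n is of the form mu'_j - j iff -1 - n is not in M, passing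
    from la' to la changes A by w ([d - 1 in M] - [d in M]), and
    A(la, mu) = A(la', mu - d) when mu - d exists. The identity for la then
    follows from the one for la', separately for mu addable, removable, or
    neither at content d. *)

From Stdlib Require Import Relation_Operators Operators_Properties.
Require Import Defs.
From mathcomp Require Import all_boot all_order all_algebra.
From mathcomp Require Import zify ring.
From mathcomp Require Import boolp classical_sets functions cardinality fsbigop.

Set Implicit Arguments.
Unset Strict Implicit.
Unset Printing Implicit Defensive.

Import Order.TTheory GRing.Theory Num.Theory.

Local Open Scope classical_set_scope.
Local Open Scope ring_scope.

(** * Partitions and their contents *)

Lemma part_anti (mu : intpart) i j :
  (0 < i)%N -> (i <= j)%N -> (part mu j <= part mu i)%N.
Proof.
case: i j => // i [|j] // _; rewrite ltnS /part /= => le_ij.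
case: (ltnP j (size mu)) => [lt_j|ge_j]; last by rewrite nth_default.
case/andP: (partsP mu) => srt _.
apply: (sorted_leq_nth (leT := geq)) => //.
- by move=> a b c; rewrite /geq /= => ba ac; exact: leq_trans ba.
- by move=> a; rewrite /geq /=.
- exact: leq_ltn_trans lt_j.
Qed.

Lemma intpart_exists (f : nat -> nat) (N : nat) :
  (forall i j, (0 < i)%N -> (i <= j)%N -> (f j <= f i)%N) ->
  (forall i, (N <= i)%N -> f i = 0%N) ->
  exists mu : intpart, forall i, (0 < i)%N -> part mu i = f i.
Proof.
move=> anti f0.
have exn : exists n, f n.+1 == 0%N by exists N; rewrite f0 // leqW.
(* The length is the first place where the next value is zero, since a list of parts may not contain
   0. *)
pose n := ex_minn exn.
have [fn0 minn] : f n.+1 = 0%N /\ forall m, f m.+1 = 0%N -> (n <= m)%N.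
  by rewrite /n; case: ex_minnP => m /eqP ? H; split=> // k /eqP /H.
pose s := mkseq (fun i => f i.+1) n.
have sP : sorted geq s && (0%N \notin s).
  apply/andP; split.
    apply: (homo_sorted (e := leq)) (iota_sorted 0 n) => i j le_ij.
    exact: anti.
  apply/negP => /mapP[i]; rewrite mem_iota /= add0n => lt_in /esym /minn.
  by rewrite leqNgt lt_in.
exists (IntPart sP) => -[//|i] _; rewrite /part /=.
case: (ltnP i n) => [lt|ge]; first by rewrite nth_mkseq.
rewrite nth_default ?size_mkseq //; apply/esym/eqP; rewrite -leqn0 -fn0.
exact: anti.
Qed.

Lemma eq_part (mu nu : intpart) :
  (forall i, (0 < i)%N -> part mu i = part nu i) -> mu = nu.
Proof.
move=> E; apply: diagram_inj; apply/seteqP; split=> -[[|i] j] [] //= _ H;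
  by split=> //=; rewrite ?E // -E.
Qed.

(** By induction on the list: once the first part is below [j], sortedness puts every later part
    below [j] too, and the count vanishes. *)
Lemma conj_partP (mu : intpart) i j :
  (0 < i)%N -> (0 < j)%N -> (i <= conj_part mu j)%N = (j <= part mu i)%N.
Proof.
case: i j => // i [//|j] _ _; rewrite /conj_part /part /=.
case/andP: (partsP mu) => + _.
elim: (parts mu) i => [|p s IH] [|i] //= srt.
- case: (ltnP j p) => // ge_p; rewrite add0n -has_count; apply/negbTE/hasPn.
  have tr : transitive geq by move=> a b c ba ac; exact: leq_trans ba.
  move=> q /(allP (order_path_min tr srt)) /= qp.
  by rewrite -ltnNge ltnS (leq_trans qp).
- have := IH i (path_sorted srt); case: (ltnP j p) => [_ <-|ge_p E].
    by rewrite add1n ltnS.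
  rewrite add0n; apply/idP/idP => [lt_i|]; first by rewrite -E ltnW.
  case: (ltnP i (size s)) => [lt_i|ge_i]; last by rewrite nth_default.
  have tr : transitive geq by move=> a b c ba ac; exact: leq_trans ba.
  have /= := allP (order_path_min tr srt) _ (mem_nth 0%N lt_i).
  by move=> H1 H2; have := leq_trans (leq_trans H2 H1) ge_p; rewrite ltnn.
Qed.

Lemma conj_part_anti (mu : intpart) i j :
  (0 < i)%N -> (i <= j)%N -> (conj_part mu j <= conj_part mu i)%N.
Proof. by move=> _ le_ij; apply: sub_count => p; exact: leq_trans. Qed.

Lemma weightE (mu : intpart) N :
  (size mu <= N)%N -> weight mu = (\sum_(i < N) part mu i.+1)%N.
Proof.
move=> le_N; rewrite /weight sumnE (big_nth 0%N).
rewrite -(big_mkord xpredT (fun i => part mu i.+1)).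
rewrite (big_cat_nat (leq0n _) le_N) /= [X in (_ + X)%N]big_nat_cond.
rewrite [X in (_ + X)%N]big1 ?addn0 //.
by move=> i /andP[/andP[le_i _] _]; rewrite /part nth_default.
Qed.

(** * Adding a single box *)

Definition adds_box (mu nu : intpart) (p : nat) : Prop :=
  (0 < p)%N /\ forall i, (0 < i)%N -> part nu i = (part mu i + (i == p))%N.

Lemma adds_boxE (mu nu : intpart) p :
  adds_box mu nu p -> part nu p = (part mu p).+1.
Proof. by case=> p0 ->; rewrite // eqxx addn1. Qed.

Lemma adds_box_diagram (mu nu : intpart) p : adds_box mu nu p ->
  diagram nu = diagram mu `|` [set (p, part nu p)].
Proof.
move=> H; have E := adds_boxE H; case: H => p0 H.
apply/seteqP; split=> -[i j] /=; rewrite /diagram /=.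
  case=> i0; rewrite (H i i0) => ij.
  have [ip|nip] := eqVneq i p; last by left; rewrite (negbTE nip) in ij; lia.
  subst i; have [?|?] := eqVneq j (part mu p).+1; last by left; lia.
  by right; rewrite E; congr pair.
case=> [[i0 ij]|[-> ->]]; last by lia.
by split=> //; rewrite H //; lia.
Qed.

Lemma adds_box_notin (mu nu : intpart) p :
  adds_box mu nu p -> ~ diagram mu (p, part nu p).
Proof. by move=> /adds_boxE E [_ /=]; rewrite E; lia. Qed.

(** Containment makes all row differences nonnegative, and they add up to 1, so exactly one row
    grows, by one box. *)
Lemma coversP (mu nu : intpart) :
  covers mu nu <-> exists p, adds_box mu nu p.
Proof.
pose N := maxn (size mu) (size nu).
have Emu : weight mu = (\sum_(i < N) part mu i.+1)%N.
  by apply: weightE; rewrite leq_maxl.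
have Enu : weight nu = (\sum_(i < N) part nu i.+1)%N.
  by apply: weightE; rewrite leq_maxr.
have big_part (ka : intpart) i : (size ka <= N)%N -> (N < i)%N -> part ka i = 0%N.
  by move=> ? ?; rewrite /part nth_default //; lia.
have hmu : (size mu <= N)%N by rewrite leq_maxl.
have hnu : (size nu <= N)%N by rewrite leq_maxr.
split=> [[sub w1]|[p H]].
  have le i : (0 < i)%N -> (part mu i <= part nu i)%N.
    case: (posnP (part mu i)) => [->//|mu0 i0].
    have /sub[_ /=] : diagram mu (i, part mu i) by split=> //=; lia.
    by lia.
  have : (\sum_(i < N) (part nu i.+1 - part mu i.+1) == 1)%N.
    rewrite sumnB; last by move=> i _; exact: le.
    by rewrite -Emu -Enu w1; lia.
  move=> /sum_nat_eq1[p [_ dp d0]]; exists p.+1; split=> // i i0.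
  have lei := le i i0; case: (ltnP N i) => [lt|ge].
    rewrite !big_part //; have [ip|//] := eqVneq i p.+1.
    by have := ltn_ord p; lia.
  have lt : (i.-1 < N)%N by lia.
  have [ip|nip] := eqVneq i p.+1; first by rewrite ip in lei *; lia.
  have /(d0 (Ordinal lt)) : Ordinal lt != p by apply/eqP => /(congr1 val) /=; lia.
  by rewrite /= prednK //; lia.
split; first by rewrite (adds_box_diagram H) => ?; left.
case: (H) => p0 Hi; have pN : (p.-1 < N)%N.
  rewrite prednK // leqNgt; apply/negP => /(big_part nu p hnu).
  by rewrite (adds_boxE H).
rewrite Emu Enu (bigD1 (Ordinal pN)) //= [in RHS](bigD1 (Ordinal pN)) //=.
rewrite prednK // (adds_boxE H) addSn; congr (_ + _).+1.
apply: eq_bigr => i nip; rewrite Hi //; case: eqP => [ip|]; last by lia.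
by case/eqP: nip; apply: val_inj => /=; lia.
Qed.

Lemma finite_covers (mu : intpart) : finite_set (covers mu).
Proof.
pose n := (weight mu).+2.
apply: (@sub_finite_set _ _ (diagram @^-1` [set B | B `<=` `I_n `*` `I_n])).
  move=> nu [_ w] [i j] /= [i0 /andP[j0 jle]]; split=> /=.
    rewrite /n ltnNge; apply/negP => lt.
    by move: jle; rewrite part_default ?w //; lia.
  by rewrite /n !ltnS (leq_trans jle) // -w part_le_weight.
apply: finite_preimage; first by move=> ? ? _ _; exact: diagram_inj.
apply: finite_subsets; exact: finite_setX.
Qed.

(** * Content sets (Maya diagrams) and bead moves *)

Definition maya (f : nat -> nat) (n : int) : Prop :=
  exists i, (0 < i)%N /\ (f i)%:Z - i%:Z = n.

Lemma part_content_inj (f : nat -> nat) i j :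
  (forall i j, (0 < i)%N -> (i <= j)%N -> (f j <= f i)%N) ->
  (0 < i)%N -> (0 < j)%N -> (f i)%:Z - i%:Z = (f j)%:Z - j%:Z -> i = j.
Proof.
move=> anti i0 j0; case: (ltngtP i j) => // lt E.
  by have := anti i j i0 (ltnW lt); lia.
by have := anti j i j0 (ltnW lt); lia.
Qed.

(** By [conj_partP], (mu_i - j) + (mu'_j - i) is either at least 0 or at most -2, never -1; this
    excludes both memberships at once. Conversely, a value missed by the row contents is located
    between two consecutive rows, which determines the column. *)
Lemma maya_conj (mu : intpart) (n : int) :
  maya (conj_part mu) n <-> ~ maya (part mu) (- n - 1).
Proof.
split=> [[j [j0 Ej]] [i [i0 Ei]]|nM].
  by have := conj_partP mu i0 j0; lia.
have ex : exists k, ((part mu k.+1)%:Z - k.+1%:Z < - n - 1)%R.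
  exists (weight mu + `|n|%N + 1)%N; rewrite part_default; lia.
pose k := ex_minn ex.
have [ltk mink] : ((part mu k.+1)%:Z - k.+1%:Z < - n - 1)%R /\
    forall m, (m < k)%N -> ((part mu m.+1)%:Z - m.+1%:Z >= - n - 1)%R.
  rewrite /k; case: ex_minnP => m H1 H2; split=> // l lt.
  by rewrite leNgt; apply/negP => /H2; lia.
(* Exactly the first [k] rows have content above -n - 1, so column j = k - n has length [k] and
   hence mu'_j - j = n. *)
have [j Ej] : exists j : nat, j%:Z = k.+1%:Z - n - 1.
  by exists `|(k.+1%:Z - n - 1)%R|%N; lia.
have j0 : (0 < j)%N by lia.
exists j; split=> //.
have H1 := conj_partP mu (ltn0Sn k) j0.
have [k0|k0] := posnP k; first by lia.
have H2 := conj_partP mu k0 j0.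
have lt : (k.-1 < k)%N by lia.
have := mink _ lt; rewrite prednK // => ge.
have : (part mu k)%:Z - k%:Z <> - n - 1 by move=> E; apply: nM; exists k.
by lia.
Qed.

(** Contents strictly decrease along the rows, so the set of contents recovers the sequence, row by
    row. *)
Lemma maya_inj (mu nu : intpart) :
  (forall n, maya (part mu) n <-> maya (part nu) n) -> mu = nu.
Proof.
have key (a b : intpart) i : (0 < i)%N ->
    (forall n, maya (part a) n -> maya (part b) n) ->
    (forall k, (0 < k < i)%N -> part a k = part b k) ->
    (part a i <= part b i)%N.
  move=> i0 sub eqs.
  have [|k [k0 Ek]] := sub ((part a i)%:Z - i%:Z); first by exists i.
  case: (leqP i k) => [le|lt].
    by have := part_anti b i0 le; lia.
  have Eab : part a k = part b k by apply: eqs; rewrite k0.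
  have := part_content_inj (@part_anti a) k0 i0; rewrite Eab => /(_ Ek).
  by lia.
move=> E; apply: eq_part => i.
elim/ltn_ind: i => i IH i0; apply/eqP; rewrite eqn_leq.
apply/andP; split; apply: key => // [n /E//|k /andP[? ?]]; first exact: IH.
by apply/esym; exact: IH.
Qed.

Definition adds_content (mu : intpart) (e : int) (nu : intpart) : Prop :=
  exists2 p, adds_box mu nu p & (part nu p)%:Z - p%:Z = e.

Lemma covers_content (mu nu : intpart) :
  covers mu nu <-> exists e, adds_content mu e nu.
Proof.
rewrite coversP; split=> [[p H]|[e [p H _]]]; last by exists p.
by exists ((part nu p)%:Z - p%:Z); exists p.
Qed.

Lemma adds_box_exists_up (mu : intpart) p : (0 < p)%N ->
  (p = 1%N \/ (part mu p < part mu p.-1)%N) -> exists nu, adds_box mu nu p.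
Proof.
move=> p0 corner.
have [] := @intpart_exists (fun i => part mu i + (i == p))%N
  (maxn (weight mu) p).+1.
- move=> i j i0 le_ij; have le := part_anti mu i0 le_ij.
  have [jp|njp] := eqVneq j p; last by lia.
  have [ip|nip] := eqVneq i p; first by lia.
  subst j; have lt : (i <= p.-1)%N by lia.
  have := part_anti mu i0 lt.
  by case: corner; lia.
- move=> i; rewrite gtn_max => /andP[? ?]; rewrite part_default //; lia.
- by move=> nu Hnu; exists nu.
Qed.

Lemma adds_box_exists_down (nu : intpart) p : (0 < p)%N ->
  (part nu p.+1 < part nu p)%N -> exists mu, adds_box mu nu p.
Proof.
move=> p0 corner.
have [] := @intpart_exists (fun i => part nu i - (i == p))%N
  (maxn (weight nu) p).+1.
- move=> i j i0 le_ij; have le := part_anti nu i0 le_ij.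
  have [ip|nip] := eqVneq i p; last by lia.
  have [jp|njp] := eqVneq j p; first by lia.
  subst i; have lt : (p.+1 <= j)%N by lia.
  have := part_anti nu (ltn0Sn p) lt.
  by lia.
- move=> i; rewrite gtn_max => /andP[? ?]; rewrite part_default //; lia.
- move=> mu Hmu; exists mu; split=> // i i0; rewrite Hmu //.
  by have [->|] := eqVneq i p; lia.
Qed.

(** Adding a box moves one bead from e - 1 to e: only row [p] changes its content, and contents of
    distinct rows differ. *)
Lemma adds_content_maya (mu nu : intpart) e : adds_content mu e nu ->
  [/\ maya (part mu) (e - 1), ~ maya (part mu) e &
      forall n, maya (part nu) n <-> n = e \/ (maya (part mu) n /\ n <> e - 1)].
Proof.
move=> [p H Ee]; have E := adds_boxE H; case: H => p0 H; split.
- by exists p; split=> //; lia.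
- move=> [i [i0 Ei]].
  have [ip|nip] := eqVneq i p; first by subst i; lia.
  have := H i i0; rewrite (negbTE nip) addn0 => Hi.
  by case/eqP: nip; apply: (part_content_inj (@part_anti nu)) => //; lia.
- move=> n; split=> [[i [i0 Ei]]|[->|[[i [i0 Ei]] ne]]].
  + have [ip|nip] := eqVneq i p; first by subst i; left; lia.
    have := H i i0; rewrite (negbTE nip) addn0 => Hi.
    right; split; first by exists i; rewrite -Hi.
    move=> En; case/eqP: nip.
    by apply: (part_content_inj (@part_anti mu)) => //; lia.
  + by exists p.
  + have [ip|nip] := eqVneq i p; first by subst i; lia.
    by exists i; rewrite H // (negbTE nip) addn0.
Qed.

(** If row [p] of content e - 1 could not grow, the row above would have the same length and
    therefore content e. *)
Lemma maya_addable (mu : intpart) e :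
  maya (part mu) (e - 1) -> ~ maya (part mu) e ->
  exists nu, adds_content mu e nu.
Proof.
move=> [p [p0 Ep]] nM.
have [|nu H] := @adds_box_exists_up mu p p0; last first.
  by exists nu, p => //; rewrite (adds_boxE H); lia.
have [->|p1] := eqVneq p 1%N; [by left | right].
have pp : (0 < p.-1)%N by lia.
have := part_anti mu pp (leq_pred p); rewrite leq_eqVlt => /orP[/eqP Epp|//].
by case: nM; exists p.-1; split=> //; lia.
Qed.

Lemma maya_removable (nu : intpart) e :
  maya (part nu) e -> ~ maya (part nu) (e - 1) ->
  exists mu, adds_content mu e nu.
Proof.
move=> [p [p0 Ep]] nM.
have [|mu H] := @adds_box_exists_down nu p p0; last by exists mu, p.
have := part_anti nu p0 (leqnSn p); rewrite leq_eqVlt => /orP[/eqP Epp|//].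
by case: nM; exists p.+1; split=> //; lia.
Qed.

(** The converse holds because the bead move can be realized by adding a box, and the content set
    determines the partition. Box additions can thus be compared as bead moves. *)
Lemma adds_contentP (mu nu : intpart) e : adds_content mu e nu <->
  [/\ maya (part mu) (e - 1), ~ maya (part mu) e &
      forall n, maya (part nu) n <-> n = e \/ (maya (part mu) n /\ n <> e - 1)].
Proof.
split=> [|[Me nMe Enu]]; first exact: adds_content_maya.
have [nu' H] := maya_addable Me nMe.
suff -> : nu = nu' by [].
apply: maya_inj => n; have [_ _ ->] := adds_content_maya H; exact: Enu.
Qed.

Lemma adds_content_maya_down (mu nu : intpart) e : adds_content mu e nu ->
  [/\ maya (part nu) e, ~ maya (part nu) (e - 1) &
      forall n, maya (part mu) n <-> n = e - 1 \/ (maya (part nu) n /\ n <> e)].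
Proof.
move=> /adds_contentP[Me nMe E]; split.
- by apply/E; left.
- by move=> /E[|[]//]; lia.
- move=> n; rewrite E; split.
    move=> Mn; have [->|ne] := pselect (n = e - 1); [by left | right].
    by split=> [|ne']; [right | apply: nMe; rewrite -ne'].
  by case=> [->//|[[->//|[//]]]].
Qed.

Lemma adds_content_uniq_up (mu nu nu' : intpart) e :
  adds_content mu e nu -> adds_content mu e nu' -> nu = nu'.
Proof.
move=> /adds_contentP[_ _ E] /adds_contentP[_ _ E'].
by apply: maya_inj => n; rewrite E E'.
Qed.

Lemma adds_content_uniq_down (mu mu' nu : intpart) e :
  adds_content mu e nu -> adds_content mu' e nu -> mu = mu'.
Proof.
move=> /adds_content_maya_down[_ _ E] /adds_content_maya_down[_ _ E'].
by apply: maya_inj => n; rewrite E E'.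
Qed.

(** * Excited diagrams and a corner of the outer shape *)

Lemma diagram_down (mu : intpart) i j i' j' :
  (0 < i' <= i)%N -> (0 < j' <= j)%N ->
  diagram mu (i, j) -> diagram mu (i', j').
Proof.
move=> /andP[i0 le_i] /andP[j0 le_j] [_ /= ij]; split=> //=.
by have := part_anti mu i0 le_i; lia.
Qed.

Lemma excited_path_sub (la : intpart) D D' :
  clos_refl_trans _ (excited_move la) D D' ->
  D' `<=` diagram la -> D `<=` diagram la.
Proof. by move=> /clos_rt_rt1n_iff[//|y z [subD _]]. Qed.

Lemma excited_diagrams_sub (la mu : intpart) D :
  excited_diagrams la mu D -> diagram mu `<=` diagram la.
Proof. by case=> ? /excited_path_sub; apply. Qed.

Lemma excited_move_sub (la : intpart) D D' :
  excited_move la D D' -> D' `<=` diagram la.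
Proof.
move=> [sub [i [j [_ _ _ [in_la _] ->]]]] x.
by case=> [[/sub//]|->].
Qed.

Section Corner.
Variables (la' la : intpart) (a : nat).
Hypothesis corner : adds_box la' la a.
Let b := part la a.

Let laE : diagram la = diagram la' `|` [set (a, b)].
Proof. exact: adds_box_diagram. Qed.

Let sub_la : diagram la' `<=` diagram la.
Proof. by rewrite laE => ?; left. Qed.

Let c_notin : ~ diagram la' (a, b).
Proof. exact: adds_box_notin. Qed.

Let c_in : diagram la (a, b).
Proof. by rewrite laE; right. Qed.

Let a0 : (0 < a)%N.
Proof. by case: c_in. Qed.

Let b0 : (0 < b)%N.
Proof. by case: c_in => _ /= /andP[]. Qed.

(** Any other such cell would lie in [la'], which would then contain the corner as well. *)
Let diagram_max i j :
  diagram la (i, j) -> (a <= i)%N -> (b <= j)%N -> i = a /\ j = b.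
Proof.
rewrite laE => -[in_la'|[-> ->//]] le_a le_b.
by case: c_notin; apply: diagram_down in_la'; lia.
Qed.

Let in_la' x : diagram la x -> x <> (a, b) -> diagram la' x.
Proof. by rewrite laE => -[|]. Qed.

Let excited_move_lift D D' : excited_move la' D D' -> excited_move la D D'.
Proof.
move=> [subD [i [j [ij [h1 h1'] [h2 h2'] [h3 h3'] E]]]].
split; first exact: subset_trans sub_la.
by exists i, j; split=> //; split=> //; exact: sub_la.
Qed.

(** A move can involve the corner only as its source or target: if it were one of the other two
    cells, the target would lie in [la] strictly beyond it. *)
Let excited_move_drop D D' :
  excited_move la D D' -> ~ D (a, b) -> ~ D' (a, b) -> excited_move la' D D'.
Proof.
move=> [subD [i [j [ij [h1 h1'] [h2 h2'] [h3 h3'] E]]]] nD nD'.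
split=> [x Dx|]; first by apply: in_la'; [exact: subD | move=> xc; subst x].
exists i, j; split=> //; split=> //; apply: in_la' => //.
- by case=> ia jb; have := @diagram_max i.+1 j.+1 h3; lia.
- by case=> ia jb; have := @diagram_max i.+1 j.+1 h3; lia.
- by move=> E3; apply: nD'; rewrite E -E3; right.
Qed.

Let corner_stuck D D' : excited_move la D D' -> D (a, b) -> D' (a, b).
Proof.
move=> [subD [i [j [ij [h1 h1'] _ _ ->]]]] Dc; left; split=> //.
by case=> ia jb; have := @diagram_max i.+1 j h1; lia.
Qed.

(** A cell that reaches the corner never leaves it, so a path ending off the corner avoids it
    throughout and runs inside [la']. *)
Lemma excited_diagrams_avoid (mu : intpart) :
  excited_diagrams la mu `&` ~` [set D | D (a, b)] = excited_diagrams la' mu.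
Proof.
apply/seteqP; split=> D.
  move=> [[subD path] /= nDc]; split=> [x Dx|].
    by apply: in_la'; [exact: subD | move=> xc; subst x].
  elim/clos_refl_trans_ind_left: path nDc => [|y z _ IH move_yz nz].
    by move=> _; exact: rt_refl.
  have ny : ~ y (a, b) by move=> yc; apply: nz; exact: corner_stuck move_yz yc.
  by apply: rt_trans (IH ny) _; apply: rt_step; exact: excited_move_drop.
move=> [subD path]; split; last by move=> /= /subD.
split; first exact: subset_trans sub_la.
elim/clos_refl_trans_ind_left: path => [|y z _ IH move_yz].
  exact: rt_refl.
by apply: rt_trans IH _; apply: rt_step; exact: excited_move_lift.
Qed.

(** * A removable box of the inner shape on the diagonal of the corner *)

Section Removable.
Variables (mu' mu : intpart) (p : nat).
Hypothesis box : adds_box mu' mu p.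
Let q := part mu p.
Hypothesis same_diag : (q + a = p + b)%N.

Let muE : diagram mu = diagram mu' `|` [set (p, q)].
Proof. exact: adds_box_diagram. Qed.

Let z_notin : ~ diagram mu' (p, q).
Proof. exact: adds_box_notin. Qed.

Let z_in : diagram mu (p, q).
Proof. by rewrite muE; right. Qed.

Let p0 : (0 < p)%N.
Proof. by case: z_in. Qed.

Let q0 : (0 < q)%N.
Proof. by case: z_in => _ /= /andP[]. Qed.

(* [(r, s)] is the current position of the box removed from [mu]: it always
   stays the last cell of [D] on its diagonal. *)
Let last_cell D D' r s :=
  [/\ clos_refl_trans _ (excited_move la') (diagram mu') D',
      D = D' `|` [set (r, s)], (s + a = r + b)%N &
      forall i j, D' (i, j) -> (j + a = i + b)%N -> (i < r)%N].

(** Otherwise the tracked cell, lying further down the same diagonal, would be beyond the corner. *)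
Let last_cell_avoid D D' r s :
  D `<=` diagram la -> last_cell D D' r s -> ~ D' (a, b).
Proof.
move=> subD [_ DE rs below] /below /(_ (addnC _ _)) lt_ar.
have := @diagram_max r s; rewrite -/b => H.
have /subD/H : D (r, s) by rewrite DE; right.
by lia.
Qed.

Let last_cell_exists D :
  clos_refl_trans _ (excited_move la) (diagram mu) D ->
  exists D' r s, last_cell D D' r s.
Proof.
elim/clos_refl_trans_ind_left => [|y z _ [D' [r [s L]]] move_yz].
  exists (diagram mu'), p, q; split=> //; first exact: rt_refl.
  move=> i j ij diag; rewrite ltnNge; apply/negP => le_pi.
  by apply: z_notin; apply: diagram_down ij; lia.
have nD'c : ~ D' (a, b) by case: move_yz => /last_cell_avoid/(_ L).
have subz := excited_move_sub move_yz.
case: L => path yE rs below.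
case: (move_yz) => suby [i [j [yij [h1 h1'] [h2 h2'] [h3 h3'] zE]]].
have nD'rs : ~ D' (r, s) by move=> /below /(_ rs); rewrite ltnn.
(* Either the tracked cell itself moves and [D'] stays fixed, or a cell of [D'] moves and the same
   move is legal in [la']. *)
have [[ir js]|nij] := pselect ((i, j) = (r, s)).
  subst i j; exists D', r.+1, s.+1; split=> //; last 2 first.
  - by lia.
  - by move=> i j /below ltr /ltr; lia.
  rewrite zE yE; congr (_ `|` _); apply/seteqP; split=> x.
    by case=> -[].
  by move=> D'x; split; [left | move=> xE; apply: nD'rs; rewrite -xE].
have D'ij : D' (i, j) by move: yij; rewrite yE => -[].
have n11 : (i.+1, j.+1) <> (r, s) by move=> E; apply: h3'; rewrite yE E; right.
have below' : (j + a = i + b)%N -> (i.+1 < r)%N.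
  move=> diag; have := below _ _ D'ij diag; rewrite leq_eqVlt => /orP[/eqP E|//].
  by case: n11; congr pair; lia.
exists (D' `\ (i, j) `|` [set (i.+1, j.+1)]), r, s; split=> //.
- apply: rt_trans path _; apply: rt_step; apply: excited_move_drop => //.
    have subD' : D' `<=` y by rewrite yE => ?; left.
    split; first exact: subset_trans suby.
    by exists i, j; split=> //; split=> // /subD'.
  (* A move of [D'] into the corner would take place on the tracked diagonal, forcing the tracked
     cell beyond the corner. *)
  case=> [[]//|[ia jb]].
  have /below' lt : (j + a = i + b)%N by lia.
  have /suby in_la : y (r, s) by rewrite yE; right.
  by have := @diagram_max r s in_la; lia.
- rewrite zE yE; apply/seteqP; split=> x.
    case=> [[[D'x|->] nx]|->]; [by left; left | by right | by left; right].
  case=> [[[D'x nx]|->]|->]; [by left; split=> //; left | by right |].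
  by left; split=> [|/esym//]; right.
- move=> k l [[D'kl _]|[-> ->]]; first exact: below.
  by move=> diag; apply: below'; lia.
Qed.

(** The removed box moves alone down its diagonal: no cell weakly southeast of it is in [mu'], and
    everything up to the corner is in [la]. *)
Let slide k : diagram mu' `<=` diagram la -> (p + k <= a)%N ->
  clos_refl_trans _ (excited_move la) (diagram mu)
    (diagram mu' `|` [set (p + k, q + k)%N]).
Proof.
move=> sub_mu'.
elim: k => [|k IH] le_a; first by rewrite !addn0 -muE; exact: rt_refl.
apply: rt_trans (IH _) _; first by lia.
apply: rt_step.
have in_la i j : (0 < i <= a)%N -> (0 < j <= b)%N -> diagram la (i, j).
  by move=> ? ?; apply: diagram_down c_in.
have nin i j : (p <= i)%N -> (q <= j)%N -> ~ diagram mu' (i, j).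
  by move=> ? ? ij; apply: z_notin; apply: diagram_down ij; lia.
split=> [x [/sub_mu'//|->]|]; first by apply: in_la; lia.
exists (p + k)%N, (q + k)%N; split; first by right.
- by split; [apply: in_la; lia | case=> [/nin|[]]; lia].
- by split; [apply: in_la; lia | case=> [/nin|[]]; lia].
- by split; [apply: in_la; lia | case=> [/nin|[]]; lia].
rewrite !addnS; congr (_ `|` _); apply/seteqP; split=> x; last by case=> -[].
move=> mu'x; split; first by left.
by move=> xE; move: mu'x; rewrite xE => /nin; lia.
Qed.

Lemma excited_diagrams_through :
  excited_diagrams la mu `&` [set D | D (a, b)] =
  (fun D => D `|` [set (a, b)]) @` excited_diagrams la' mu'.
Proof.
apply/seteqP; split=> D.
  move=> [[subD /last_cell_exists[D' [r [s L]]]] /= Dc].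
  have nD'c := last_cell_avoid subD L; case: L => path DE rs below.
  have [ar bs] : (a, b) = (r, s) by move: Dc; rewrite DE => -[].
  exists D'; last by rewrite DE ar bs.
  split=> // x D'x; apply: in_la'; first by apply: subD; rewrite DE; left.
  by move=> xc; subst x.
move=> [D' [subD' path] <-]; split; last by right.
split=> [x [/subD'/sub_la//|->//]|].
have sub_mu' := excited_path_sub path subD'.
(* If the box lay beyond the corner, the corner would be a cell of [mu'], hence of [la']. *)
have le_pa : (p <= a)%N.
  rewrite leqNgt; apply/negP => lt_ap; apply: c_notin; apply: sub_mu'.
  have in_mu : diagram mu (a, b) by apply: diagram_down z_in; lia.
  by move: in_mu; rewrite muE => -[//|[]]; lia.
have := @slide (a - p) (subset_trans sub_mu' sub_la).
have -> : (p + (a - p) = a)%N by lia.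
have -> : (q + (a - p) = b)%N by lia.
(* First the box slides into the corner; then the path of [la'] is replayed, its cells all differing
   from the corner. *)
move=> /(_ (leqnn a)) path0; apply: rt_trans path0 _.
clear subD'; elim/clos_refl_trans_ind_left: path => [|y z _ IH move_yz].
  exact: rt_refl.
apply: rt_trans IH _; apply: rt_step.
case: move_yz => suby [i [j [yij [h1 h1'] [h2 h2'] [h3 h3'] zE]]].
have nc x : diagram la' x -> x <> (a, b) by move=> + xc; rewrite xc.
split=> [x [/suby/sub_la//|->//]|].
exists i, j; split; first by left.
- by split; [exact: sub_la | case=> // /nc; apply].
- by split; [exact: sub_la | case=> // /nc; apply].
- by split; [exact: sub_la | case=> // /nc; apply].
rewrite zE; apply/seteqP; split=> x.
  case=> [[[yx nx]|->]|->]; [by left; split=> //; left | by right |].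
  by left; split; [right | move=> E; apply: (nc _ (suby _ yij))].
by case=> [[[yx|->] nx]|->]; [left; left | right | left; right].
Qed.

End Removable.

(* A cell of [mu] just right of, or just below, the last cell of its diagonal
   keeps blocking that diagonal, so no cell can be pushed into the corner. *)
Lemma excited_diagrams_blocked (mu : intpart) :
  (forall mu', ~ adds_content mu' (b%:Z - a%:Z) mu) ->
  excited_diagrams la mu `&` [set D | D (a, b)] = set0.
Proof.
move=> nrem; apply/seteqP; split=> // D [[subD path] /= Dc].
(* The witness has content d + 1 (below: d - 1), where d is the content of the corner, and no cell
   of content d lies in a lower row (below: in a column further right) than the witness. *)
pose right_blocked (D : set (nat * nat)) := exists i j,
  [/\ D (i, j), (j + a = i + b + 1)%N &
      forall k l, D (k, l) -> (l + a = k + b)%N -> (k <= i)%N].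
pose below_blocked (D : set (nat * nat)) := exists i j,
  [/\ D (i, j), (j + a + 1 = i + b)%N &
      forall k l, D (k, l) -> (l + a = k + b)%N -> (l <= j)%N].
have right_step y z : excited_move la y z -> right_blocked y -> right_blocked z.
  move=> [suby [i [j [yij [h1 h1'] [h2 h2'] [h3 h3'] ->]]]] [k [l [ykl kl le]]].
  have [[ik jl]|nij] := pselect ((i, j) = (k, l)).
    exists k.+1, l.+1; split; [by right; rewrite ik jl | by lia |].
    by move=> r s [[/le+ _]|[-> ->]]; lia.
  exists k, l; split=> //; first by left; split=> // /esym.
  move=> r s [[/le+ _]|[-> ->]] // diag.
  (* A cell of content d in the row of the witness cannot move, because the witness occupies its
     right neighbour. *)
  have := le _ _ yij; have [ik|] := eqVneq i k; last by lia.
  have jl : l = j.+1 by lia.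
  by case: h2'; rewrite -jl ik.
have below_step y z : excited_move la y z -> below_blocked y -> below_blocked z.
  move=> [suby [i [j [yij [h1 h1'] [h2 h2'] [h3 h3'] ->]]]] [k [l [ykl kl le]]].
  have [[ik jl]|nij] := pselect ((i, j) = (k, l)).
    exists k.+1, l.+1; split; [by right; rewrite ik jl | by lia |].
    by move=> r s [[/le+ _]|[-> ->]]; lia.
  exists k, l; split=> //; first by left; split=> // /esym.
  move=> r s [[/le+ _]|[-> ->]] // diag.
  have := le _ _ yij; have [jl|] := eqVneq j l; last by lia.
  have ik : k = i.+1 by lia.
  by case: h1'; rewrite -ik jl.
have empty_step y z : excited_move la y z ->
    (forall i j, y (i, j) -> (j + a <> i + b)%N) ->
    (forall i j, z (i, j) -> (j + a <> i + b)%N).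
  move=> [suby [i [j [yij _ _ _ ->]]]] H k l [[/H//]|[-> ->]].
  by have := H _ _ yij; lia.
have [|H0] := pselect (forall i j, diagram mu (i, j) -> (j + a <> i + b)%N).
  move=> H0; have : forall i j, D (i, j) -> (j + a <> i + b)%N.
    by elim/clos_refl_trans_ind_left: path => // y z _ IH /empty_step/(_ IH).
  by move=> /(_ _ _ Dc); lia.
(* The last cell of [mu] on the diagonal exists because [mu] is finite. *)
have [p [q [pq diag last_pq]]] : exists p q, [/\ diagram mu (p, q),
    (q + a = p + b)%N & ~ diagram mu (p.+1, q.+1)].
  apply: contrapT => nex; apply: H0 => i j ij diag.
  have all_in k : diagram mu (i + k, j + k)%N.
    elim: k => [|k IH]; first by rewrite !addn0.
    rewrite !addnS; apply: contrapT => nin; apply: nex.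
    by exists (i + k)%N, (j + k)%N; split=> //; lia.
  have [_ /= ] := all_in (weight mu).+1.
  by have := part_le_weight mu (i + (weight mu).+1); lia.
have [p0 q0] : (0 < p)%N /\ (0 < q)%N by case: pq => /= ? /andP[].
have lastP k l : diagram mu (k, l) -> (l + a = k + b)%N -> (k <= p)%N.
  move=> kl dkl; rewrite leqNgt; apply/negP => lt; apply: last_pq.
  by apply: diagram_down kl; lia.
have [right_in|right_out] := pselect (diagram mu (p, q.+1)).
  have [i [j [Dij ij le]]] : right_blocked D.
    elim/clos_refl_trans_ind_left: path => [|y z _ IH /right_step/(_ IH)//].
    by exists p, q.+1; split=> //; lia.
  (* With the corner in [D], the witness lies weakly southeast of it in [la], so it would be the
     corner, whose content differs. *)
  by have := @diagram_max i j (subD _ Dij); have := le _ _ Dc; lia.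
have [below_in|below_out] := pselect (diagram mu (p.+1, q)).
  have [i [j [Dij ij le]]] : below_blocked D.
    elim/clos_refl_trans_ind_left: path => [|y z _ IH /below_step/(_ IH)//].
    exists p.+1, q; split=> //; first by lia.
    by move=> k l /lastP; lia.
  by have := @diagram_max i j (subD _ Dij); have := le _ _ Dc; lia.
(* With both neighbours absent, the last cell is a removable box of content d, contrary to
   assumption. *)
have Eq : part mu p = q.
  apply/eqP; rewrite eqn_leq; case: pq => _ /= /andP[_ ->].
  by rewrite andbT leqNgt; apply/negP => lt; apply: right_out; split.
have [|mu' H] := @adds_box_exists_down mu p p0.
  by rewrite Eq ltnNge; apply/negP => le; apply: below_out; split=> //=; lia.
by apply: (nrem mu'); exists p => //; rewrite Eq; lia.
Qed.

End Corner.

(** * The linear factor and the recursion *)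

Lemma eq_from_leq m n :
  (forall i, (0 < i)%N -> (i <= m)%N = (i <= n)%N) -> m = n.
Proof.
move=> E; apply/eqP; rewrite eqn_leq; apply/andP; split.
  by case: m E => // m E; rewrite -E.
by case: n E => // n E; rewrite E.
Qed.

Lemma adds_box_conj_corner (la' la : intpart) a : adds_box la' la a ->
  conj_part la (part la a) = a.
Proof.
move=> H; have Eb := adds_boxE H; case: H => a0 H.
apply: eq_from_leq => i i0; rewrite conj_partP // ?Eb // -Eb.
case: (leqP i a) => [le|lt]; first by rewrite part_anti.
rewrite (H i i0) Eb; have := part_anti la' a0 (ltnW lt).
by have [?|] := eqVneq i a; lia.
Qed.

Lemma adds_box_conj (la' la : intpart) a k : adds_box la' la a -> (0 < k)%N ->
  conj_part la k = (conj_part la' k + (k == part la a))%N.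
Proof.
move=> H k0; have [kb|nkb] := eqVneq k (part la a).
  rewrite kb (adds_box_conj_corner H).
  have Eb := adds_boxE H; case: H => a0 H.
  rewrite -[a in LHS]prednK // addn1; congr _.+1.
  apply: eq_from_leq => i i0; rewrite conj_partP //; last by rewrite -kb.
  case: (leqP a i) => [le|lt].
    by have := part_anti la' a0 le; lia.
  have := part_anti la i0 (ltnW lt); rewrite (H i i0).
  by have [?|] := eqVneq i a; lia.
have Eb := adds_boxE H; case: H => a0 H.
rewrite addn0; apply: eq_from_leq => i i0; rewrite !conj_partP // H //.
by have [->|_] := eqVneq i a; [lia | rewrite addn0].
Qed.

Lemma row_indicesE (la mu : intpart) k :
  row_indices la mu k <->
  (0 < k)%N /\ ~ maya (part mu) ((part la k)%:Z - k%:Z).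
Proof.
by split=> -[k0 nM]; split=> // -[i [i0 E]]; apply: nM; exists i.
Qed.

(** By [maya_conj], the row and column conditions both become tests on the single content set of
    [mu]. *)
Lemma col_indicesE (la mu : intpart) k :
  col_indices la mu k <->
  (0 < k)%N /\ maya (part mu) (- ((conj_part la k)%:Z - k%:Z) - 1).
Proof.
have -> : col_indices la mu k =
    ((0 < k)%N /\ ~ maya (conj_part mu) ((conj_part la k)%:Z - k%:Z)).
  by apply/propext; split=> -[k0 nM]; split=> // -[i [i0 E]]; apply: nM; exists i.
by rewrite maya_conj; split=> -[k0 H]; split=> //; apply: contrapT.
Qed.

Lemma fsumD1_if (V : nmodType) (I : choiceType) (A : set I) (f : I -> V) k :
  finite_set A ->
  \sum_(i \in A) f i =
    \sum_(i \in A `\ k) f i + (if `[< A k >] then f k else 0).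
Proof.
move=> finA; case: asboolP => [Ak|nAk]; first by rewrite (fsbigD1 k) // addrC.
by rewrite addr0 not_setD1.
Qed.

(** * Weighted sums over excited diagrams and induction on the outer shape *)

Section Recursion.
Variables (V : comNzRingType) (x y : nat -> V).

Definition cell_prod (D : set (nat * nat)) : V :=
  \big[*%R/1]_(c \in D) (x c.1 + y c.2).

Lemma cell_prodU1 (D : set (nat * nat)) c : finite_set D -> ~ D c ->
  cell_prod (D `|` [set c]) = (x c.1 + y c.2) * cell_prod D.
Proof.
move=> finD nDc; rewrite /cell_prod fsbigU0 //; first by rewrite fsbig_set1 mulrC.
by move=> z [Dz zc]; apply: nDc; rewrite -zc.
Qed.

Definition excited_sum (la mu : intpart) : V :=
  \sum_(D \in excited_diagrams la mu) cell_prod D.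

Definition index_sum (la mu : intpart) : V :=
  \sum_(k \in row_indices la mu) x k
  + \sum_(k \in col_indices la mu) y k.

Lemma excited_sum0 (la mu : intpart) :
  ~ diagram mu `<=` diagram la -> excited_sum la mu = 0.
Proof. by move=> nsub; apply: fsbig1 => D /excited_diagrams_sub. Qed.

Section Corner.
Variables (la' la : intpart) (a : nat).
Hypothesis corner : adds_box la' la a.
Let b := part la a.
Let d : int := b%:Z - a%:Z.
Let w : V := x a + y b.

Lemma excited_sum_removable (mu' mu : intpart) : adds_content mu' d mu ->
  excited_sum la mu = excited_sum la' mu + w * excited_sum la' mu'.
Proof.
move=> [p box diag]; have eqd : (part mu p + a = p + b)%N by move: diag; lia.
rewrite {1}/excited_sum (fsbigID [set D : set (nat * nat) | D (a, b)]);
  last exact: finite_excited_diagrams.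
rewrite (excited_diagrams_avoid corner) addrC; congr (_ + _).
rewrite (excited_diagrams_through corner box) //.
have nin D : excited_diagrams la' mu' D -> ~ D (a, b).
  by move=> [subD _] /subD; exact: adds_box_notin.
(* Adding the corner is injective here because diagrams inside [la'] miss it. *)
rewrite (reindex_fsbig (fun D => D `|` [set (a, b)]) (excited_diagrams la' mu'));
  last first.
  split; [by move=> D HD; exists D | | by []].
  move=> D1 D2; rewrite !inE => H1 H2 E.
  apply/seteqP; split=> z Dz.
    have : (D1 `|` [set (a, b)]) z by left.
    by rewrite E => -[//|zc]; case: (nin _ H1); rewrite -zc.
  have : (D2 `|` [set (a, b)]) z by left.
  by rewrite -E => -[//|zc]; case: (nin _ H2); rewrite -zc.
rewrite /excited_sum fsbig_distrr; last exact: finite_excited_diagrams.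
apply: eq_fsbigr => D; rewrite inE => HD.
rewrite cell_prodU1 //; last exact: nin.
by case: HD => subD _; exact: sub_finite_set (finite_diagram la').
Qed.

Lemma excited_sum_blocked (mu : intpart) :
  (forall mu', ~ adds_content mu' d mu) ->
  excited_sum la mu = excited_sum la' mu.
Proof.
move=> nrem.
rewrite {1}/excited_sum (fsbigID [set D : set (nat * nat) | D (a, b)]);
  last exact: finite_excited_diagrams.
rewrite (excited_diagrams_avoid corner) (excited_diagrams_blocked corner nrem).
by rewrite fsbig_set0; exact: add0r.
Qed.

(** [T] collects the rows other than [a] and the columns other than [b]; these never test d or d -
    1, so they see no difference between the two pairs. Row [a] tests d in [la] and d - 1 in [la'],
    while column [b] tests d - 1 in [la] and d in [la']. *)
Lemma index_sum_corner (mu mu' : intpart) :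
  (forall n, n <> d -> n <> d - 1 ->
     maya (part mu) n <-> maya (part mu') n) ->
  exists T,
    index_sum la mu = T + (if `[< maya (part mu) d >] then 0 else x a)
      + (if `[< maya (part mu) (d - 1) >] then y b else 0) /\
    index_sum la' mu' =
      T + (if `[< maya (part mu') (d - 1) >] then 0 else x a)
      + (if `[< maya (part mu') d >] then y b else 0).
Proof.
move=> agree; have Eb := adds_boxE corner.
have conj_b := adds_box_conj_corner corner.
have conjE := adds_box_conj corner; case: (corner) => a0 partE.
have b0 : (0 < b)%N by rewrite /b Eb.
have conj_b' : (conj_part la' b).+1 = a.
  by have := conjE _ b0; rewrite eqxx -/b conj_b addn1.
have rowE k : k <> a -> row_indices la mu k <-> row_indices la' mu' k.
  move=> nka; rewrite !row_indicesE.
  have [->|k0] := posnP k; first by split=> -[].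
  have Ek : part la k = part la' k.
    by rewrite partE //; have [//|] := eqVneq k a; rewrite addn0.
  have nd : (part la k)%:Z - k%:Z <> d.
    by move=> /(part_content_inj (@part_anti la) k0 a0).
  have nd1 : (part la k)%:Z - k%:Z <> d - 1.
    rewrite Ek => E; apply: nka; apply: (part_content_inj (@part_anti la')) => //.
    by rewrite E /d /b Eb; lia.
  by rewrite -Ek; split=> -[_ nM]; split=> // /(agree _ nd nd1).
have colE k : k <> b -> col_indices la mu k <-> col_indices la' mu' k.
  move=> nkb; rewrite !col_indicesE.
  have [->|k0] := posnP k; first by split=> -[].
  have Ek : conj_part la k = conj_part la' k.
    by rewrite conjE //; have [//|] := eqVneq k (part la a); rewrite addn0.
  set n := - _ - 1.
  have nd1 : n <> d - 1.
    move=> E; apply: nkb; apply: (part_content_inj (@conj_part_anti la)) => //.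
    by rewrite -/b conj_b; lia.
  have nd : n <> d.
    move=> E; apply: nkb; apply: (part_content_inj (@conj_part_anti la')) => //.
    by lia.
  by rewrite -Ek -/n; split=> -[_ M]; split=> //; apply/(agree _ nd nd1).
exists (\sum_(k \in row_indices la mu `\ a) x k
        + \sum_(k \in col_indices la mu `\ b) y k).
rewrite /index_sum (fsumD1_if _ a (finite_row_indices la mu)).
rewrite (fsumD1_if _ a (finite_row_indices la' mu')).
rewrite (fsumD1_if _ b (finite_col_indices la mu)).
rewrite (fsumD1_if _ b (finite_col_indices la' mu')).
have -> : row_indices la' mu' `\ a = row_indices la mu `\ a.
  by apply/seteqP; split=> k [/= + nk]; split=> //; apply/(rowE _ nk).
have -> : col_indices la' mu' `\ b = col_indices la mu `\ b.
  by apply/seteqP; split=> k [/= + nk]; split=> //; apply/(colE _ nk).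
have asb (P Q : Prop) : (P <-> Q) -> `[< P >] = `[< Q >].
  by move=> /propext ->.
have -> : `[< row_indices la mu a >] = ~~ `[< maya (part mu) d >].
  by rewrite -asbool_neg; apply: asb; rewrite row_indicesE; split=> [[]|].
have -> : `[< row_indices la' mu' a >] = ~~ `[< maya (part mu') (d - 1) >].
  rewrite -asbool_neg; apply: asb; rewrite row_indicesE.
  have -> : (part la' a)%:Z - a%:Z = d - 1 by rewrite /d /b Eb; lia.
  by split=> [[]|].
have -> : `[< col_indices la mu b >] = `[< maya (part mu) (d - 1) >].
  apply: asb; rewrite col_indicesE.
  have -> : - ((conj_part la b)%:Z - b%:Z) - 1 = d - 1 by rewrite conj_b /d; lia.
  by split=> [[]|].
have -> : `[< col_indices la' mu' b >] = `[< maya (part mu') d >].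
  apply: asb; rewrite col_indicesE.
  have -> : - ((conj_part la' b)%:Z - b%:Z) - 1 = d by rewrite /d; lia.
  by split=> [[]|].
by split; rewrite if_neg addrACA addrA.
Qed.

Let removable : set intpart := [set nu | exists ka, adds_content ka d nu].
(** This is the operation mu - d, with value [nu] itself if no box of content d can be removed. *)
Let strip (nu : intpart) : intpart := xget nu [set ka | adds_content ka d nu].

Let stripE ka nu : adds_content ka d nu -> strip nu = ka.
Proof.
move=> H; apply: xget_unique => // ka' H'; exact: adds_content_uniq_down H' H.
Qed.

Let covers_sum_corner mu :
  \sum_(nu \in covers mu) excited_sum la nu =
  \sum_(nu \in covers mu) excited_sum la' nu +
  w * \sum_(nu \in covers mu `&` removable) excited_sum la' (strip nu).
Proof.
have fin : finite_set (covers mu `&` removable).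
  by apply: sub_finite_set (finite_covers mu) => ? [].
rewrite (fsbigID removable) /=; last exact: finite_covers.
rewrite [in RHS](fsbigID removable) /=; last exact: finite_covers.
rewrite addrAC; congr (_ + _).
  rewrite fsbig_distrr // -fsbig_split //=; apply: eq_fsbigr => nu.
  by rewrite inE => -[_ [ka H]]; rewrite (stripE H) (excited_sum_removable H).
apply: eq_fsbigr => nu; rewrite inE => -[_ nrem]; apply: excited_sum_blocked.
by move=> ka H; apply: nrem; exists ka.
Qed.

(* Adding the box of content [d] commutes with adding any other box. *)
Let strip_bij mu' mu : adds_content mu' d mu ->
  set_bij (covers mu `&` removable) (covers mu' `\ mu) strip.
Proof.
move=> H; have [Md nMd1 E'] := adds_content_maya_down H.
have /adds_contentP[M'd1 nM'd _] := H.
split.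
- move=> nu [/covers_content[e He] [ka Hka]]; rewrite (stripE Hka).
  have [Nd nNd1 Ek] := adds_content_maya_down Hka.
  have /adds_contentP[Me1 nMe En] := He.
  (* The content e is none of d - 1, d, d + 1, so the bead moves for e and d use disjoint pairs of
     positions and commute. *)
  have ed : e <> d by move=> ed; apply: nMe; rewrite ed.
  have ed1 : e <> d - 1 by move=> ed1; apply: nNd1; apply/En; left.
  have e1d : e - 1 <> d by move=> e1d; move: Nd => /En[|[_]]; lia.
  split.
    apply/covers_content; exists e; apply/adds_contentP; split.
    + by apply/E'; right.
    + by move=> /E'[|[]].
    + move=> n; rewrite Ek En E'.
      have [->|n1] := pselect (n = d - 1).
        by split=> [_|[_|_]]; [right; split; [left | lia] | left | left].
      have [->|n2] := pselect (n = d); last by tauto.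
      by split=> [[|[]]|[|[[|[]]]]] //; lia.
  by move=> kamu; have := Ek d; rewrite kamu; case=> /(_ Md)[|[]//]; lia.
- move=> nu nu'; rewrite !inE => -[_ [ka Hka]] [_ [ka' Hka']].
  rewrite (stripE Hka) (stripE Hka') => kaE; subst ka'.
  exact: adds_content_uniq_up Hka Hka'.
- move=> ka [/covers_content[e He] kamu].
  have ed : e <> d.
    by move=> ed; subst e; apply: kamu; exact: adds_content_uniq_up He H.
  have /adds_contentP[M'e1 nM'e Ek] := He.
  have e1d : e - 1 <> d by move=> e1d; apply: nM'd; rewrite -e1d.
  have ed1 : e <> d - 1 by move=> ed1; apply: nM'e; rewrite ed1.
  have Kd1 : maya (part ka) (d - 1) by apply/Ek; right; split=> //; lia.
  have nKd : ~ maya (part ka) d by move=> /Ek[|[]//]; exact/nesym.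
  (* The preimage is [ka] with its box of content d added. *)
  have [nu Hnu] := maya_addable Kd1 nKd; exists nu; last exact: stripE.
  have /adds_contentP[_ _ En] := Hnu.
  split; last by exists ka.
  apply/covers_content; exists e; apply/adds_contentP; split.
  + by move: M'e1 => /E'[|[]//]; lia.
  + by move=> Me; apply: nM'e; apply/E'; right.
  + move=> n; rewrite En Ek E'.
    have [->|n1] := pselect (n = d - 1).
      by split=> [[|[_]]|[|[]]] //; lia.
    have [->|n2] := pselect (n = d); last by tauto.
    by split=> [_|_]; [right; split=> //; lia | left].
Qed.

Lemma index_excited_step :
  (forall mu, index_sum la' mu * excited_sum la' mu =
    \sum_(nu \in covers mu) excited_sum la' nu) ->
  forall mu, index_sum la mu * excited_sum la mu =
    \sum_(nu \in covers mu) excited_sum la nu.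
Proof.
move=> IH mu; rewrite covers_sum_corner -IH.
have [Md|nMd] := pselect (maya (part mu) d);
  have [Md1|nMd1] := pselect (maya (part mu) (d - 1)).
(* Both positions occupied: no cover of [mu] has a removable box of content d, and neither A nor F
   changes with the corner. *)
- have -> : covers mu `&` removable = set0.
    apply/seteqP; split=> // nu [/covers_content[e He] [ka Hka]].
    have [Nd nNd1 _] := adds_content_maya_down Hka.
    have /adds_contentP[_ nMe En] := He.
    apply: nNd1; apply/En; right; split=> // ed.
    by apply: nMe; rewrite -(subrK 1 e) -ed subrK.
  have nrem mu' : ~ adds_content mu' d mu.
    by move=> /adds_content_maya_down[].
  have [T [-> ->]] := @index_sum_corner mu mu (fun _ _ _ => iff_refl _).
  rewrite (excited_sum_blocked nrem) fsbig_set0.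
  by rewrite (asboolT Md) (asboolT Md1) mulr0 !addr0.
- have [mu' H] := maya_removable Md nMd1.
  have /adds_contentP[M'd1 nM'd E] := H.
  have [T [ET ET']] := @index_sum_corner mu mu (fun _ _ _ => iff_refl _).
  have [|U [EU EU']] := @index_sum_corner mu mu'.
    by move=> n nd nd1; rewrite E; tauto.
  move: ET ET' EU EU'; rewrite (asboolT Md) (asboolF nMd1) (asboolT M'd1).
  rewrite (asboolF nM'd) !addr0 => ET ET' EU EU'.
  rewrite -(reindex_fsbig _ _ _ _ (strip_bij H)).
  have cov : covers mu' mu by apply/covers_content; exists d.
  (* The hypothesis for [mu'] has one cover that is no stripped cover of [mu], namely [mu] itself.
     Its term, times w, accounts for A(la', mu) = A(la, mu) + w. *)
  have := IH mu'; rewrite (fsbigD1 mu _ _ (finite_covers mu') cov) /=.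
  rewrite (excited_sum_removable H) ET' EU' -EU ET => IHmu'.
  rewrite mulrDr mulrCA IHmu' /w; ring.
(* Addable case: the only cover with a removable box of content d is [nu0], which strips back to
   [mu]; its term w F(la', mu) matches the growth of A by w. *)
- have [nu0 H] := maya_addable Md1 nMd.
  have -> : covers mu `&` removable = [set nu0].
    apply/seteqP; split=> [nu [/covers_content[e He] [ka Hka]]|nu ->].
      have [Nd nNd1 _] := adds_content_maya_down Hka.
      have /adds_contentP[_ nMe En] := He.
      have de : d = e by move: Nd => /En[|[]].
      by subst e; exact: adds_content_uniq_up He H.
    by split; [apply/covers_content; exists d | exists mu].
  have nrem mu' : ~ adds_content mu' d mu.
    by move=> /adds_content_maya_down[].
  have [T [-> ->]] := @index_sum_corner mu mu (fun _ _ _ => iff_refl _).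
  rewrite (excited_sum_blocked nrem) fsbig_set1 (stripE H).
  by rewrite (asboolT Md1) (asboolF nMd) /w; ring.
- have -> : covers mu `&` removable = set0.
    apply/seteqP; split=> // nu [/covers_content[e He] [ka Hka]].
    have [Nd nNd1 _] := adds_content_maya_down Hka.
    have /adds_contentP[Me1 nMe En] := He.
    have de : d = e by move: Nd => /En[|[]].
    by apply: nMd1; rewrite de.
  have nrem mu' : ~ adds_content mu' d mu.
    by move=> /adds_content_maya_down[].
  have [T [-> ->]] := @index_sum_corner mu mu (fun _ _ _ => iff_refl _).
  rewrite (excited_sum_blocked nrem) fsbig_set0.
  by rewrite (asboolF nMd1) (asboolF nMd) mulr0 !addr0.
Qed.

End Corner.

Lemma index_sum_self (la : intpart) : index_sum la la = 0.
Proof.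
rewrite /index_sum !fsbig1 ?addr0 // => k [k0 []]; by exists k.
Qed.

(** Induction on the size of [la]. Summing over all covers, where those not inside [la] contribute
    0, keeps containment out of the induction. *)
Lemma index_excited_covers (la mu : intpart) :
  index_sum la mu * excited_sum la mu =
  \sum_(nu \in covers mu) excited_sum la nu.
Proof.
have [n] := ubnP (weight la); elim: n la mu => // n IH la mu wn.
(* For empty [la], F vanishes unless [mu] is empty, and then A vanishes; no cover is empty. *)
have [la0|la_gt0] := posnP (size la).
  have empty (nu : intpart) : nu <> la -> excited_sum la nu = 0.
    move=> nula; apply: excited_sum0 => sub; apply: nula; apply: diagram_inj.
    apply/seteqP; split=> // -[i j] [_ /=].
    by rewrite /part nth_default ?la0 //; lia.
  rewrite fsbig1; last first.
    move=> nu cov; apply: empty => nula; subst nu.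
    by case: cov => _; rewrite /weight (size0nil la0).
  have [->|/empty ->] := pselect (mu = la); last by rewrite mulr0.
  by rewrite index_sum_self mul0r.
(* The last nonzero row always ends in a removable corner. *)
have corner : (part la (size la).+1 < part la (size la))%N.
  rewrite {1}/part nth_default //=; case/andP: (partsP la) => _ n0.
  rewrite lt0n; apply/negP => /eqP E; case/negP: n0; rewrite -E.
  by rewrite /part mem_nth // prednK.
have [la' box] := adds_box_exists_down la_gt0 corner.
apply: (index_excited_step box) => nu; apply: IH.
have [_ w1] : covers la' la by apply/coversP; exists (size la).
by rewrite -ltnS -w1.
Qed.

Lemma index_excited_covers_in (la mu : intpart) :
  index_sum la mu * excited_sum la mu =
  \sum_(nu \in [set nu | covers mu nu /\ diagram nu `<=` diagram la])
    excited_sum la nu.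
Proof.
rewrite index_excited_covers; apply/esym/fsbig_widen => [nu []//|nu [cov nsub]].
by apply: excited_sum0 => sub; apply: nsub.
Qed.

End Recursion.

Theorem theorem3p5 (R : comNzRingType) (la mu : intpart) :
  (\sum_(k \in row_indices la mu) xvar R k
     + \sum_(k \in col_indices la mu) yvar R k)
    * (\sum_(D \in excited_diagrams la mu) cell_weight R D)
  = \sum_(nu \in [set nu : intpart |
                    covers mu nu /\ diagram nu `<=` diagram la])
      \sum_(D \in excited_diagrams la nu) cell_weight R D.
(* The identity holds for arbitrary families in a commutative ring; the indeterminates are one
   instance. *)
Proof. exact: (index_excited_covers_in (xvar R) (yvar R)). Qed.
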